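(* Let $0<\alpha<1$ and $0\leqslant\beta<1$, and consider the difference equation $x_{n+1}=\alpha+\beta x_{n-1}+\frac{x_{n-1}}{x_n}$, $n=0,1,2,\ldots$, with positive initial conditions $x_{-1},x_0$, together with its associated planar map $T(y,z)=\left(z,\ \alpha+\beta y+\frac{y}{z}\right)$, where $y=x_{n-1}$, $z=x_n$. Put $\bar x=\frac{1+\alpha}{1-\beta}$, so that $(\bar x,\bar x)$ is the saddle fixed point of $T$. Define $$\theta=\sqrt{1+4\bar x+4\beta\bar x^2},\qquad \lambda_1=\frac{-1-\theta}{2\bar x},\qquad \lambda_2=\frac{-1+\theta}{2\bar x},$$ $$b_2=\frac{1-\theta+2\beta\bar x}{\theta(\theta-1)(\lambda_2^2-\lambda_1)\bar x},$$ $$b_3=\frac{b_2}{(\lambda_2^3-\lambda_1)\bar x}\left[\lambda_1-\lambda_2^2+\frac{1+2\beta\bar x}{\theta\bar x}\left(\frac1{\lambda_2}+\frac{\lambda_2}{\lambda_1}\right)-\frac{\lambda_2}{\lambda_1\bar x}\right],$$ $$\gamma_1=-\frac{1+\beta\bar x}{\theta},\qquad \gamma_2=\frac{\theta-1}{2\theta},\qquad \gamma_3=\frac{\theta+1}{2\theta},$$ and $$S(x,y)=\gamma_1(x-\bar x)+\gamma_3(y-\bar x)-b_2\left[\gamma_1(x-\bar x)-\gamma_2(y-\bar x)\right]^2+b_3\left[\gamma_1(x-\bar x)-\gamma_2(y-\bar x)\right]^3 .$$ Then the local stable manifold of the equation corresponding to the saddle point $\bar x$ has the asymptotic equation $S(\tilde\psi(y),y)=0$.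 That is, let $\tilde\psi$ be the smooth function defined near $\bar x$ and determined by $\tilde\psi(\bar x)=\bar x$ and $S(\tilde\psi(y),y)=0$. Then, in a neighborhood of $(\bar x,\bar x)$, the local stable manifold of $T$ at $(\bar x,\bar x)$ is the graph $\{(\sigma(y),y)\}$ of a smooth function $\sigma$ defined near $\bar x$ with $$\sigma(y)=\tilde\psi(y)+O\left(|y-\bar x|^4\right)\quad\text{as } y\to\bar x .$$
   Context: The map $T$ acts on $(0,\infty)^2$; it is a diffeomorphism onto its image near $(\bar x,\bar x)$, and $(\bar x,\bar x)$ is its unique fixed point. The numbers $\lambda_1,\lambda_2$ are the eigenvalues of $DT(\bar x,\bar x)$; for $0<\alpha<1$ one has $|\lambda_1|>1$ and $|\lambda_2|<1$, so the fixed point is a saddle. For a (sufficiently small) neighborhood $\mathcal N$ of a fixed point $p$ of a diffeomorphism $T$, the local stable manifold is $W^s(p,\mathcal N)=\{\mathbf x\in\mathcal N:\ T^{n}(\mathbf x)\in\mathcal N\text{ for all }n\geqslant 0,\ T^{n}(\mathbf x)\to p\text{ as }n\to\infty\}$. In the plane, a point $(x,y)$ corresponds to $(x_{n-1},x_n)$. *)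

(* Defs.v *)
From Stdlib Require Import Reals.
From Coquelicot Require Import Coquelicot.
Open Scope R_scope.

(* A sequence with x_{n+1} = alpha + beta x_{n-1} + x_{n-1} / x_n satisfies
   (x_n, x_{n+1}) = planar_map alpha beta (x_{n-1}, x_n).  The map is meant on
   (0,oo)^2; elsewhere its values are an artefact of the total division. *)
Definition planar_map (alpha beta : R) (p : R * R) : R * R :=
  (snd p, alpha + beta * fst p + fst p / snd p).

Definition xbar (alpha beta : R) : R := (1 + alpha) / (1 - beta).

Definition theta (alpha beta : R) : R :=
  let x := xbar alpha beta in sqrt (1 + 4 * x + 4 * beta * x ^ 2).

Definition lambda1 (alpha beta : R) : R :=
  (- 1 - theta alpha beta) / (2 * xbar alpha beta).

Definition lambda2 (alpha beta : R) : R :=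
  (- 1 + theta alpha beta) / (2 * xbar alpha beta).

Definition b2 (alpha beta : R) : R :=
  let x := xbar alpha beta in
  let t := theta alpha beta in
  let l1 := lambda1 alpha beta in
  let l2 := lambda2 alpha beta in
  (1 - t + 2 * beta * x) / (t * (t - 1) * (l2 ^ 2 - l1) * x).

Definition b3 (alpha beta : R) : R :=
  let x := xbar alpha beta in
  let t := theta alpha beta in
  let l1 := lambda1 alpha beta in
  let l2 := lambda2 alpha beta in
  b2 alpha beta / ((l2 ^ 3 - l1) * x) *
  (l1 - l2 ^ 2 + (1 + 2 * beta * x) / (t * x) * (1 / l2 + l2 / l1)
   - l2 / (l1 * x)).

Definition gamma1 (alpha beta : R) : R :=
  - ((1 + beta * xbar alpha beta) / theta alpha beta).

Definition gamma2 (alpha beta : R) : R :=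
  (theta alpha beta - 1) / (2 * theta alpha beta).

Definition gamma3 (alpha beta : R) : R :=
  (theta alpha beta + 1) / (2 * theta alpha beta).

Definition S_poly (alpha beta x y : R) : R :=
  let u := x - xbar alpha beta in
  let v := y - xbar alpha beta in
  let w := gamma1 alpha beta * u - gamma2 alpha beta * v in
  gamma1 alpha beta * u + gamma3 alpha beta * v
  - b2 alpha beta * w ^ 2 + b3 alpha beta * w ^ 3.

(* C^infinity on some open interval around x0; one interval serves all orders. *)
Definition smooth_near (f : R -> R) (x0 : R) : Prop :=
  locally x0 (fun y => forall n : nat, ex_derive_n f n y).

(* Functions "defined near xbar" are total functions considered only through
   their values near xbar. *)
Definition is_psi (alpha beta : R) (psi : R -> R) : Prop :=
  smooth_near psi (xbar alpha beta) /\
  psi (xbar alpha beta) = xbar alpha beta /\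
  locally (xbar alpha beta) (fun y => S_poly alpha beta (psi y) y = 0).

Definition local_stable_manifold {X : UniformSpace} (F : X -> X) (p : X)
    (N : X -> Prop) (x : X) : Prop :=
  N x /\
  (forall n : nat, N (Nat.iter n F x)) /\
  filterlim (fun n : nat => Nat.iter n F x) eventually (locally p).

(* For all sufficiently small neighborhoods N of p inside (0,oo)^2, W^s(p, N)
   coincides near p with {(sigma y, y)}.  The neighborhood of coincidence
   depends on N, since an arbitrary N need not be adapted to the dynamics. *)
Definition stable_manifold_is_graph (F : R * R -> R * R) (p : R * R)
    (sigma : R -> R) : Prop :=
  exists N0 : R * R -> Prop,
    locally p N0 /\
    (forall q, N0 q -> 0 < fst q /\ 0 < snd q) /\
    forall N : R * R -> Prop,
      locally p N -> (forall q, N q -> N0 q) ->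
      locally p (fun q =>
        local_stable_manifold F p N q <-> fst q = sigma (snd q)).

(* Main.v *)
(** The stable manifold is parametrized by an orbit: [x_n = X + u (l ^ n * t)]
    with [X] the equilibrium and [l = lambda2].  Substituting
    [u t = t + a2 t^2 + a3 t^3 + ...] into the recurrence gives a quadratic
    recursion for the coefficients without small divisors, so the series
    converges.  The curve [t |-> (X + u t, X + u (l t))] is the graph of
    [sigma = (X + u) o tau], where [tau] inverts the second coordinate.  Points of
    the curve contract to the fixed point, while the horizontal distance to the
    curve expands by a factor close to [|lambda1| > 1], so that no other orbit
    stays nearby.  On the curve the cubic [S] vanishes to order 4 in [t], which is
    what the values of [b2] and [b3] express.  Solving [S = 0] by inverting a cubic
    in one variable then yields [psi], at a distance from the curve controlled by
    [S]. *)

Require Import Defs.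
From Stdlib Require Import Reals Lra Lia IndefiniteDescription.
From Coquelicot Require Import Coquelicot.
Open Scope R_scope.

(** * Differentiability classes and local inverses *)

(** Each order carries a witness for the derivative that is constrained on [U] only. Closure under
    sums, products, composition and reciprocals then follows by induction on [n], with no formula
    for higher derivatives. *)
Fixpoint differentiable_upto (n : nat) (U : R -> Prop) (f : R -> R) : Prop :=
  match n with
  | O => True
  | S k => exists f' : R -> R,
      (forall x, U x -> is_derive f x (f' x)) /\ differentiable_upto k U f'
  end.

Lemma differentiable_upto_pred n U f :
  differentiable_upto (S n) U f -> differentiable_upto n U f.
Proof.
  revert f; induction n as [|n IH]; intros f; [easy|].
  intros [f' [Hf Hn]]. exists f'. split; [exact Hf|]. apply IH, Hn.
Qed.

Lemma differentiable_upto_subset n (U V : R -> Prop) f :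
  (forall x, V x -> U x) ->
  differentiable_upto n U f -> differentiable_upto n V f.
Proof.
  intros HVU; revert f; induction n as [|n IH]; intros f; [easy|].
  intros [f' [Hf Hn]]. exists f'. split; [|now apply IH].
  intros x Hx. now apply Hf, HVU.
Qed.

Lemma differentiable_upto_ext n (U : R -> Prop) f g : open U ->
  (forall x, U x -> f x = g x) ->
  differentiable_upto n U f -> differentiable_upto n U g.
Proof.
  intros HU Hfg; destruct n as [|n]; [easy|].
  intros [f' [Hf Hn]]. exists f'. split; [|exact Hn].
  intros x Hx. apply is_derive_ext_loc with f; [|now apply Hf].
  generalize (HU x Hx). apply filter_imp, Hfg.
Qed.

Lemma differentiable_upto_const n U c : differentiable_upto n U (fun _ => c).
Proof.
  revert c; induction n as [|n IH]; intros c; [easy|].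
  exists (fun _ => 0). split; [|apply IH].
  intros x _. apply (is_derive_const c x).
Qed.

Lemma differentiable_upto_id n U : differentiable_upto n U (fun x => x).
Proof.
  destruct n as [|n]; [easy|].
  exists (fun _ => 1). split; [|apply differentiable_upto_const].
  intros x _. apply (is_derive_id x).
Qed.

Lemma differentiable_upto_plus n U f g :
  differentiable_upto n U f -> differentiable_upto n U g ->
  differentiable_upto n U (fun x => f x + g x).
Proof.
  revert f g; induction n as [|n IH]; intros f g; [easy|].
  intros [f' [Hf Hf']] [g' [Hg Hg']].
  exists (fun x => f' x + g' x). split; [|now apply IH].
  intros x Hx. apply (is_derive_plus f g x); auto.
Qed.

Lemma differentiable_upto_mult n U f g :
  differentiable_upto n U f -> differentiable_upto n U g ->
  differentiable_upto n U (fun x => f x * g x).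
Proof.
  revert f g; induction n as [|n IH]; intros f g; [easy|].
  intros Hf Hg.
  pose proof (differentiable_upto_pred _ _ _ Hf) as Hf0.
  pose proof (differentiable_upto_pred _ _ _ Hg) as Hg0.
  destruct Hf as [f' [Hf Hf']], Hg as [g' [Hg Hg']].
  exists (fun x => f' x * g x + f x * g' x).
  split; [|apply differentiable_upto_plus; now apply IH].
  intros x Hx. apply (is_derive_mult f g x); auto.
  intros; apply Rmult_comm.
Qed.

Lemma differentiable_upto_comp n (U V : R -> Prop) f g :
  (forall x, U x -> V (g x)) ->
  differentiable_upto n V f -> differentiable_upto n U g ->
  differentiable_upto n U (fun x => f (g x)).
Proof.
  intros HUV; revert f g HUV; induction n as [|n IH]; intros f g HUV; [easy|].
  intros [f' [Hf Hf']] Hg.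
  pose proof (differentiable_upto_pred _ _ _ Hg) as Hg0.
  destruct Hg as [g' [Hg Hg']].
  exists (fun x => g' x * f' (g x)).
  split; [|apply differentiable_upto_mult; auto].
  intros x Hx. apply (is_derive_comp f g x); auto.
Qed.

Lemma differentiable_upto_inv n (U : R -> Prop) f :
  (forall x, U x -> f x <> 0) ->
  differentiable_upto n U f -> differentiable_upto n U (fun x => / f x).
Proof.
  intros Hnz; induction n as [|n IH]; [easy|].
  intros Hf. specialize (IH (differentiable_upto_pred _ _ _ Hf)).
  destruct Hf as [f' [Hf Hf']].
  exists (fun x => (-1 * f' x) * (/ f x * / f x)). split.
  - intros x Hx. generalize (is_derive_inv f x (f' x) (Hf x Hx) (Hnz x Hx)).
    replace (- f' x / f x ^ 2) with ((-1 * f' x) * (/ f x * / f x)); [easy|].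
    field. auto.
  - repeat apply differentiable_upto_mult; auto using differentiable_upto_const.
Qed.

Lemma differentiable_upto_Derive n (U : R -> Prop) f : open U ->
  differentiable_upto (S n) U f -> differentiable_upto n U (Derive f).
Proof.
  intros HU [f' [Hf Hn]]. apply differentiable_upto_ext with f'; auto.
  intros x Hx. symmetry. apply is_derive_unique, Hf, Hx.
Qed.

Lemma differentiable_upto_is_derive n (U : R -> Prop) f x :
  differentiable_upto (S n) U f -> U x -> is_derive f x (Derive f x).
Proof.
  intros [f' [Hf _]] Hx. apply Derive_correct. exists (f' x). auto.
Qed.

Lemma differentiable_upto_continuous n (U : R -> Prop) f x :
  differentiable_upto (S n) U f -> U x -> continuous f x.
Proof.
  intros Hf Hx. apply (ex_derive_continuous f x).
  exists (Derive f x). now apply differentiable_upto_is_derive with n U.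
Qed.

Lemma differentiable_upto_ex_derive_n n (U : R -> Prop) f x : open U ->
  differentiable_upto n U f -> U x -> ex_derive_n f n x.
Proof.
  intros HU; revert f x; induction n as [|n IH]; intros f x Hf Hx; [easy|].
  destruct n as [|n].
  { exists (Derive f x). now apply differentiable_upto_is_derive with O U. }
  (* The induction hypothesis is applied to [Derive f], whose derivatives are those of [f] shifted
     by one order. *)
  pose proof (IH _ x (differentiable_upto_Derive _ _ _ HU Hf) Hx) as H.
  revert H. apply ex_derive_ext. intros t.
  change (Derive f) with (Derive_n f 1).
  rewrite Derive_n_comp. f_equal. lia.
Qed.

Lemma smooth_near_of_differentiable_upto (U : R -> Prop) f x0 :
  open U -> U x0 -> (forall n, differentiable_upto n U f) -> smooth_near f x0.
Proof.
  intros HU Hx0 Hf. unfold smooth_near.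
  generalize (HU x0 Hx0). apply filter_imp. intros x Hx n. now apply differentiable_upto_ex_derive_n with U.
Qed.

Lemma open_Rabs_lt (a d : R) : open (fun x => Rabs (x - a) < d).
Proof.
  intros x Hx. assert (H : 0 < d - Rabs (x - a)) by lra.
  exists (mkposreal _ H). intros y Hy.
  change (Rabs (y - x) < d - Rabs (x - a)) in Hy.
  replace (y - a) with ((y - x) + (x - a)) by ring.
  generalize (Rabs_triang (y - x) (x - a)). lra.
Qed.

Lemma locally_Rabs (a d : R) : 0 < d -> locally a (fun x => Rabs (x - a) < d).
Proof.
  intros Hd. exists (mkposreal d Hd). now intros y Hy.
Qed.

Lemma locally_Rabs_inv (a : R) (P : R -> Prop) : locally a P ->
  exists d, 0 < d /\ forall x, Rabs (x - a) < d -> P x.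
Proof.
  intros [d Hd]. exists d. split; [apply cond_pos|]. intros x Hx. now apply Hd.
Qed.

Lemma continuous_locally_Rabs (f : R -> R) a v e :
  continuous f a -> f a = v -> 0 < e ->
  locally a (fun x => Rabs (f x - v) < e).
Proof.
  intros Hf <- He. apply (Hf (fun z => Rabs (z - f a) < e)). now apply locally_Rabs.
Qed.

(** By the mean value theorem the difference is [(f' c - f' a) * (y - x)] with [c] between [x] and
    [y], and continuity of [f'] at [a] makes the first factor small. Both [x] and [y] vary, as local
    injectivity and the expansion estimate require. *)
Lemma strict_derivative (f f' : R -> R) (a eps : R) :
  locally a (fun x => is_derive f x (f' x)) -> continuous f' a -> 0 < eps ->
  exists d, 0 < d /\ forall x y, Rabs (x - a) < d -> Rabs (y - a) < d ->
    Rabs (f y - f x - f' a * (y - x)) <= eps * Rabs (y - x).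
Proof.
  intros Hf Hc Heps.
  destruct (locally_Rabs_inv _ _
    (filter_and _ _ Hf (continuous_locally_Rabs _ _ _ _ Hc eq_refl Heps))) as [d [Hd H]].
  exists d. split; [exact Hd|]. intros x y Hx Hy.
  assert (Hin : forall c, Rmin x y <= c <= Rmax x y -> Rabs (c - a) < d).
  { intros c. unfold Rmin, Rmax. destruct (Rle_dec x y); intros Hc1;
      apply Rabs_def2 in Hx; apply Rabs_def2 in Hy; apply Rabs_def1; lra. }
  destruct (MVT_gen f x y f') as [c [Hc1 Hc2]].
  - intros c Hc1. apply H, Hin. lra.
  - intros c Hc1. apply continuity_pt_filterlim.
    apply (ex_derive_continuous f c). exists (f' c). now apply H, Hin.
  - rewrite Hc2, <- Rmult_minus_distr_r, Rabs_mult.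
    apply Rmult_le_compat_r; [apply Rabs_pos|].
    left. now apply H, Hin.
Qed.

(** Differentiability of [f] at [g y] gives an error small relative to [g z - g y]. The Lipschitz
    bound makes it small relative to [z - y], and also yields the continuity of [g] at [y]. *)
Lemma is_derive_local_inverse (f g : R -> R) (y l L : R) :
  is_derive f (g y) l -> l <> 0 -> locally y (fun z => f (g z) = z) ->
  locally y (fun z => Rabs (g z - g y) <= L * Rabs (z - y)) ->
  is_derive g y (/ l).
Proof.
  intros [_ Hf] Hl Hinv HL.
  pose proof (locally_singleton _ _ Hinv) as Hy. simpl in Hy.
  assert (HcG : filterlim g (locally y) (locally (g y))).
  { intros P HP. change (locally y (fun z => P (g z))).
    destruct (locally_Rabs_inv _ _ HP) as [d [Hd HdP]].
    assert (Hd' : 0 < d / (1 + Rabs L)).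
    { apply Rdiv_lt_0_compat; [easy|]. generalize (Rabs_pos L). lra. }
    generalize (filter_and _ _ HL (locally_Rabs y _ Hd')).
    apply filter_imp. intros z [H1 H2]. apply HdP.
    apply Rle_lt_trans with (1 := H1).
    pose proof (Rabs_pos L). pose proof (Rle_abs L).
    apply Rle_lt_trans with ((1 + Rabs L) * Rabs (z - y)).
    - apply Rmult_le_compat_r; [apply Rabs_pos|lra].
    - apply Rmult_lt_reg_l with (/ (1 + Rabs L)).
      + apply Rinv_0_lt_compat. lra.
      + rewrite <- Rmult_assoc, Rinv_l by lra. unfold Rdiv in H2. lra. }
  split; [apply is_linear_scal_l|].
  intros x Hx.
  pose proof (@is_filter_lim_locally_unique R_AbsRing
    (AbsRing_NormedModule R_AbsRing) y x Hx) as Heq. subst x. intros eps.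
  (* After the Lipschitz bound and a division by [Rabs l] this tolerance becomes [eps]. The
     denominator [1 + Rabs L] is positive whatever the sign of [L]. *)
  assert (He : 0 < eps * Rabs l / (1 + Rabs L)).
  { pose proof (Rabs_pos L). apply Rdiv_lt_0_compat; [|lra].
    apply Rmult_lt_0_compat; [apply cond_pos|now apply Rabs_pos_lt]. }
  specialize (Hf (g y) (fun P H => H) (mkposreal _ He)). simpl in Hf.
  generalize (filter_and _ _ (filter_and _ _ Hinv HL) (HcG _ Hf)).
  apply filter_imp. intros z [[H1 H2] H3].
  change (Rabs (f (g z) - f (g y) - (g z - g y) * l)
    <= eps * Rabs l / (1 + Rabs L) * Rabs (g z - g y)) in H3.
  change (Rabs (g z - g y - (z - y) * / l) <= eps * Rabs (z - y)).
  rewrite H1, Hy in H3.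
  replace (g z - g y - (z - y) * / l)
    with (- (z - y - (g z - g y) * l) * / l) by (now field).
  rewrite Rabs_mult, Rabs_Ropp, Rabs_inv.
  pose proof (Rabs_pos_lt _ Hl) as Hl'. pose proof (Rabs_pos L) as HL0.
  apply Rmult_le_reg_r with (Rabs l); [easy|].
  rewrite Rmult_assoc, Rinv_l, Rmult_1_r by lra.
  apply Rle_trans with (1 := H3).
  apply Rle_trans with (eps * Rabs l / (1 + Rabs L) * ((1 + Rabs L) * Rabs (z - y))).
  - apply Rmult_le_compat_l; [now left|].
    apply Rle_trans with (1 := H2).
    apply Rmult_le_compat_r; [apply Rabs_pos|]. generalize (Rle_abs L). lra.
  - right. field. lra.
Qed.

(** With tolerance [l / 2] around the slope [l], [f] increases at rate at least [l / 2] near [a].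
    The intermediate value theorem gives preimages, the rate gives the Lipschitz constant [2 / l],
    and the formula [g' = 1 / f'(g)] raises the regularity of [g] one order at a time. *)
Lemma local_inverse (U : R -> Prop) (f : R -> R) (a l : R) :
  open U -> U a -> (forall n, differentiable_upto n U f) ->
  is_derive f a l -> 0 < l ->
  exists (g : R -> R) (V : R -> Prop),
    open V /\ V (f a) /\ (forall y, V y -> U (g y) /\ f (g y) = y) /\
    locally a (fun x => g (f x) = x) /\
    (forall n, differentiable_upto n V g) /\
    exists L, 0 <= L /\
      forall y z, V y -> V z -> Rabs (g z - g y) <= L * Rabs (z - y).
Proof.
  intros HU Ha Hsm Hfa Hl.
  assert (HD : forall x, U x -> is_derive f x (Derive f x)).
  { intros x. now apply differentiable_upto_is_derive with O, Hsm. }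
  assert (HcD : continuous (Derive f) a).
  { apply differentiable_upto_continuous with O U; [|easy].
    now apply differentiable_upto_Derive. }
  assert (Hl' : Derive f a = l) by (now apply is_derive_unique).
  assert (Hl2 : 0 < l / 2) by lra.
  destruct (strict_derivative f (Derive f) a (l / 2)) as [d1 [Hd1 Hstr]].
  { generalize (HU a Ha). now apply filter_imp. }
  { exact HcD. }
  { exact Hl2. }
  destruct (locally_Rabs_inv _ _
    (filter_and _ _ (HU a Ha) (continuous_locally_Rabs _ _ _ _ HcD eq_refl Hl2)))
    as [d2 [Hd2 Hloc]].
  (* Halving puts the closed ball of radius [d], with its endpoints [a - d] and [a + d], inside both
     open balls. *)
  set (d := Rmin d1 d2 / 2).
  assert (Hd : 0 < d /\ d < d1 /\ d < d2).
  { unfold d, Rmin. destruct (Rle_dec d1 d2); lra. }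
  assert (Hmono : forall x y, Rabs (x - a) <= d -> Rabs (y - a) <= d -> x <= y ->
    l / 2 * (y - x) <= f y - f x).
  { intros x y Hx Hy Hxy.
    assert (H : Rabs (f y - f x - Derive f a * (y - x)) <= l / 2 * Rabs (y - x))
      by (apply Hstr; lra).
    rewrite Hl', (Rabs_pos_eq (y - x)) in H by lra.
    apply Rabs_le_between in H. lra. }
  assert (Hend : Rabs (a - d - a) <= d /\ Rabs (a + d - a) <= d).
  { split; apply Rabs_le; lra. }
  (* Choice needs a value for every [y]; outside the interval the condition is vacuous and [0]
     serves as default. *)
  assert (Hex : forall y, exists x, f (a - d) < y < f (a + d) ->
    Rabs (x - a) < d /\ f x = y).
  { intros y. destruct (Rlt_dec (f (a - d)) y) as [H1|]; [|exists 0; lra].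
    destruct (Rlt_dec y (f (a + d))) as [H2|]; [|exists 0; lra].
    destruct (Ranalysis5.IVT_interv (fun x => f x - y) (a - d) (a + d))
      as [x [Hx1 Hx2]]; try lra.
    - intros x Hx. apply continuity_pt_minus.
      + apply continuity_pt_filterlim, (ex_derive_continuous f x).
        exists (Derive f x). apply HD, Hloc. apply Rabs_def1; lra.
      + now apply continuity_pt_const.
    - exists x. intros _. split; [|lra].
      assert (x <> a - d) by (intros ->; lra).
      assert (x <> a + d) by (intros ->; lra).
      apply Rabs_def1; lra. }
  destruct (functional_choice _ Hex) as [g Hg]; clear Hex.
  exists g, (fun y => f (a - d) < y < f (a + d)).
  assert (HV : open (fun y => f (a - d) < y < f (a + d))).
  { apply open_and; [apply open_gt|apply open_lt]. }
  assert (HinV : forall x, Rabs (x - a) < d -> f (a - d) < f x < f (a + d)).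
  { intros x Hx. pose proof (Rabs_def2 _ _ Hx).
    split.
    - assert (l / 2 * (x - (a - d)) <= f x - f (a - d)) by (apply Hmono; lra).
      assert (0 < l / 2 * (x - (a - d))) by (apply Rmult_lt_0_compat; lra). lra.
    - assert (l / 2 * (a + d - x) <= f (a + d) - f x) by (apply Hmono; lra).
      assert (0 < l / 2 * (a + d - x)) by (apply Rmult_lt_0_compat; lra). lra. }
  assert (HLip : forall y z, Rabs (y - a) < d -> Rabs (z - a) < d ->
    Rabs (z - y) <= 2 / l * Rabs (f z - f y)).
  { assert (Hw : forall y z, Rabs (y - a) < d -> Rabs (z - a) < d -> y <= z ->
      Rabs (z - y) <= 2 / l * Rabs (f z - f y)).
    { intros y z Hy Hz Hyz. rewrite Rabs_pos_eq by lra.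
      assert (H : l / 2 * (z - y) <= f z - f y) by (apply Hmono; lra).
      apply Rmult_le_reg_l with (l / 2); [lra|].
      replace (l / 2 * (2 / l * Rabs (f z - f y))) with (Rabs (f z - f y))
        by (field; lra).
      generalize (Rle_abs (f z - f y)). lra. }
    intros y z Hy Hz. destruct (Rle_dec y z) as [H|H]; [now apply Hw|].
    rewrite (Rabs_minus_sym z), (Rabs_minus_sym (f z)). apply Hw; lra. }
  assert (HgL : forall y z, f (a - d) < y < f (a + d) ->
    f (a - d) < z < f (a + d) -> Rabs (g z - g y) <= 2 / l * Rabs (z - y)).
  { intros y z Hy Hz. destruct (Hg y Hy) as [Hy1 Hy2], (Hg z Hz) as [Hz1 Hz2].
    rewrite <- Hy2 at 2. rewrite <- Hz2 at 2. now apply HLip. }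
  split; [exact HV|]. split.
  { apply HinV. rewrite Rminus_diag, Rabs_R0. lra. }
  split.
  { intros y Hy. destruct (Hg y Hy) as [H1 H2]. split; [apply Hloc; lra|easy]. }
  split.
  { generalize (locally_Rabs a d (proj1 Hd)). apply filter_imp. intros x Hx.
    destruct (Hg (f x) (HinV x Hx)) as [H1 H2].
    pose proof (HLip _ _ Hx H1) as H3.
    rewrite H2, Rminus_diag, Rabs_R0, Rmult_0_r in H3.
    generalize (Rabs_pos (g (f x) - x)). intros H4.
    assert (H5 : Rabs (g (f x) - x) = 0) by lra.
    apply Rabs_eq_0 in H5. lra. }
  split; [|exists (2 / l); split; [apply Rlt_le, Rdiv_lt_0_compat; lra|exact HgL]].
  assert (HD0 : forall x, Rabs (x - a) < d -> Derive f x <> 0).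
  { intros x Hx. assert (H : Rabs (Derive f x - Derive f a) < l / 2)
      by (apply Hloc; lra).
    apply Rabs_def2 in H. lra. }
  intros n; induction n as [|n IH]; [easy|].
  exists (fun y => / Derive f (g y)). split.
  - intros y Hy. destruct (Hg y Hy) as [H1 H2].
    apply (is_derive_local_inverse f g y (Derive f (g y)) (2 / l)).
    + apply HD, Hloc. lra.
    + now apply HD0.
    + generalize (HV y Hy). apply filter_imp. intros z Hz. apply Hg, Hz.
    + generalize (HV y Hy). apply filter_imp. intros z Hz. now apply HgL.
  - apply differentiable_upto_inv.
    + intros y Hy. apply HD0, Hg, Hy.
    + apply differentiable_upto_comp with U; [|now apply differentiable_upto_Derive|easy].
      intros y Hy. destruct (Hg y Hy) as [H1 _]. apply Hloc. lra.
Qed.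

(** * Power series of the stable curve *)

(** [c N] is a table of the entries up to index [N]. Later tables agree with it there and [G n]
    reads only entries up to [n], so the diagonal satisfies the recursion. *)
Lemma course_of_values (b0 : R) (G : nat -> (nat -> R) -> R) :
  (forall n f g, (forall k, (k <= n)%nat -> f k = g k) -> G n f = G n g) ->
  exists b : nat -> R, b O = b0 /\ forall n, b (S n) = G n b.
Proof.
  intros HG.
  pose (c := fix c (N : nat) : nat -> R :=
    match N with
    | O => fun _ => b0
    | S M => fun n => if Nat.leb n M then c M n else G M (c M)
    end).
  assert (Hc : forall N n, (n <= N)%nat -> c N n = c n n).
  { induction N as [|N IH]; intros n Hn.
    - now replace n with O by lia.
    - destruct (Nat.eq_dec n (S N)) as [->|Hne]; [easy|].
      simpl c at 1. rewrite (proj2 (Nat.leb_le n N)) by lia. apply IH. lia. }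
  exists (fun n => c n n). split; [easy|]. intros n.
  change (c (S n) (S n)) with (if Nat.leb (S n) n then c n (S n) else G n (c n)).
  rewrite (proj2 (Nat.leb_gt (S n) n)) by lia.
  apply HG. intros k Hk. now apply Hc.
Qed.

(* The partial sums [s_N] of [|b_n| r^n] satisfy
   [s_(N+1) <= |b_0| + r K s_N^2], which keeps them below [2 (|b_0| + 1)]
   for small [r]. *)
Lemma CV_radius_quadratic_recursion (b : nat -> R) (K : R) : 0 < K ->
  (forall n, Rabs (b (S n)) <=
    K * sum_f_R0 (fun k => Rabs (b k) * Rabs (b (n - k)%nat)) n) ->
  exists r, 0 < r /\ Rbar_lt r (CV_radius b).
Proof.
  intros HK Hb.
  set (m := Rabs (b O) + 1).
  assert (Hm : 1 <= m) by (unfold m; generalize (Rabs_pos (b O)); lra).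
  (* Chosen so that [m + r * K * (2 * m) ^ 2 = 2 * m]. *)
  set (r := / (4 * K * m)).
  assert (HKm : 0 < 4 * K * m) by (apply Rmult_lt_0_compat; lra).
  assert (Hr : 0 < r) by now apply Rinv_0_lt_compat.
  set (t := fun n => Rabs (b n) * r ^ n).
  assert (Ht : forall n, 0 <= t n).
  { intros n. apply Rmult_le_pos; [apply Rabs_pos|]. apply pow_le. lra. }
  assert (Hpart : forall N, sum_f_R0 t N <= 2 * m).
  { induction N as [|N IH].
    { unfold t, m. simpl. generalize (Rabs_pos (b O)). lra. }
    (* The products [t k * t j] with [k + j <= N] are among the terms of the squared partial sum,
       and all terms are nonnegative. *)
    assert (Hconv : sum_f_R0 (fun n => sum_f_R0 (fun k => t k * t (n - k)%nat) n) N
      <= sum_f_R0 t N * sum_f_R0 t N).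
    { destruct N as [|N]; [simpl; lra|].
      rewrite (cauchy_finite t t (S N)) by lia.
      match goal with |- ?A <= ?B + ?C => enough (0 <= C) by (unfold Rle in *; lra) end.
      apply cond_pos_sum. intros k. apply cond_pos_sum. intros j.
      now apply Rmult_le_pos. }
    rewrite decomp_sum by lia. simpl pred.
    apply Rle_trans with (m + r * K * (2 * m * (2 * m))).
    2: { right. unfold r. field. lra. }
    apply Rplus_le_compat.
    { unfold t, m. simpl. lra. }
    apply Rle_trans with (r * K * (sum_f_R0 t N * sum_f_R0 t N)).
    2: { apply Rmult_le_compat_l; [apply Rmult_le_pos; lra|].
         apply Rmult_le_compat; try easy; now apply cond_pos_sum. }
    apply Rle_trans with
      (r * K * sum_f_R0 (fun n => sum_f_R0 (fun k => t k * t (n - k)%nat) n) N).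
    2: { apply Rmult_le_compat_l; [apply Rmult_le_pos; lra|easy]. }
    rewrite scal_sum. apply sum_Rle. intros n _.
    replace (sum_f_R0 (fun k => t k * t (n - k)%nat) n)
      with (sum_f_R0 (fun k => Rabs (b k) * Rabs (b (n - k)%nat)) n * r ^ n).
    2: { rewrite Rmult_comm, scal_sum. apply sum_eq. intros k Hk. unfold t.
         replace n with (k + (n - k))%nat at 2 by lia. rewrite pow_add. ring. }
    unfold t. simpl pow.
    apply Rle_trans with
      (K * sum_f_R0 (fun k => Rabs (b k) * Rabs (b (n - k)%nat)) n * (r * r ^ n)).
    2: { right. ring. }
    apply Rmult_le_compat_r; [|apply Hb].
    apply Rmult_le_pos; [lra|]. apply pow_le. lra. }
  (* Boundedness of the terms at [r] only shows that the radius is at least [r]; halving makes the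
     inequality strict. *)
  exists (r / 2). split; [lra|].
  apply Rbar_lt_le_trans with r; [simpl; lra|].
  apply (proj1 (CV_radius_bounded b)). exists (2 * m). intros n.
  rewrite Rabs_mult, (Rabs_pos_eq (r ^ n)) by (apply pow_le; lra).
  apply Rle_trans with (2 := Hpart n). fold (t n).
  destruct n as [|n]; [simpl; lra|].
  simpl. generalize (cond_pos_sum t n Ht). lra.
Qed.

Lemma PSeries_scal_arg (b : nat -> R) (c t : R) :
  PSeries (fun n => c ^ n * b n) t = PSeries b (c * t).
Proof.
  unfold PSeries. apply Series_ext. intros n. rewrite Rpow_mult_distr. ring.
Qed.

Lemma CV_radius_multiplier (c b : nat -> R) : (forall n, Rabs (c n) <= 1) ->
  Rbar_le (CV_radius b) (CV_radius (fun n => c n * b n)).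
Proof.
  intros Hc. apply CV_radius_bounded. intros r [M HM].
  apply (proj1 (CV_radius_bounded _)). exists M. intros n.
  rewrite Rmult_assoc, Rabs_mult.
  apply Rle_trans with (2 := HM n). rewrite <- (Rmult_1_l (Rabs (b n * r ^ n))) at 2.
  apply Rmult_le_compat_r; [apply Rabs_pos|apply Hc].
Qed.

Lemma pow_unit_interval (c : R) (n : nat) : 0 <= c <= 1 -> 0 <= c ^ n <= 1.
Proof.
  intros Hc. split; [now apply pow_le|]. rewrite <- (pow1 n). now apply pow_incr.
Qed.

Lemma differentiable_upto_PSeries (b : nat -> R) (r : R) n :
  Rbar_le r (CV_radius b) ->
  differentiable_upto n (fun t => Rabs t < r) (PSeries b).
Proof.
  revert b; induction n as [|n IH]; intros b Hr; [easy|].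
  exists (PSeries (PS_derive b)). split.
  - intros t Ht. apply is_derive_PSeries. now apply Rbar_lt_le_trans with r.
  - apply IH. now rewrite CV_radius_derive.
Qed.

(* With [u t = t * v t], this is the equation for the orbit
   [x_n = X + u (l ^ n * t)], divided by [t]. *)
Lemma stable_series (X l beta : R) : 0 < X -> 0 < l < 1 -> 0 <= beta <= 1 ->
  beta * X + 1 = X * l ^ 2 + l ->
  exists (b : nat -> R) (r : R), 0 < r /\ Rbar_lt r (CV_radius b) /\
    b O = 1 /\
    (X * (l ^ 4 - l ^ 2) + (l ^ 2 - l)) * b 1%nat = - (l * (l ^ 2 - beta)) /\
    (X * (l ^ 6 - l ^ 2) + (l ^ 3 - l)) * b 2%nat =
      - (l * (l * (l ^ 2 - beta) + (l ^ 4 - beta)) * b 1%nat) /\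
    forall t, Rabs t < r ->
      X * l ^ 2 * PSeries b (l ^ 2 * t) + l * PSeries b (l * t)
      - (beta * X + 1) * PSeries b t
      + t * (l * PSeries b (l * t) *
             (l ^ 2 * PSeries b (l ^ 2 * t) - beta * PSeries b t)) = 0.
Proof.
  intros HX Hl Hbeta Heq.
  (* [D n], the factor of [b (S n)] in the linear part, is the characteristic polynomial
     [X * z ^ 2 + z - (beta * X + 1)] at [z = l ^ (n + 2)]. It vanishes at [z = l] and increases for
     positive [z], so [D n] stays below a negative constant. *)
  set (D := fun n => X * ((l ^ 2) ^ (S n) * l ^ 2 - l ^ 2) + (l ^ S n * l - l)).
  assert (Hll : 0 < l * (1 - l)) by (apply Rmult_lt_0_compat; lra).
  assert (Hl2 : 0 < l ^ 2 < 1).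
  { split; [apply pow_lt; lra|]. simpl. nra. }
  assert (Hmul : forall k, Rabs ((l ^ 2) ^ k * l ^ 2 - beta) <= 1).
  { intros k. pose proof (pow_unit_interval (l ^ 2) k ltac:(lra)).
    assert (0 <= (l ^ 2) ^ k * l ^ 2 <= 1) by nra.
    apply Rabs_le. lra. }
  assert (HD : forall n, D n <= - (l * (1 - l))).
  { intros n. unfold D.
    assert (Hp : forall c, 0 < c < 1 -> 0 <= c ^ S n <= c).
    { intros c Hc. split; [apply pow_le; lra|]. simpl.
      rewrite <- (Rmult_1_r c) at 3. apply Rmult_le_compat_l; [lra|].
      apply pow_unit_interval. lra. }
    pose proof (Hp l Hl). pose proof (Hp _ Hl2).
    assert (X * ((l ^ 2) ^ S n * l ^ 2 - l ^ 2) <= 0).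
    { assert ((l ^ 2) ^ S n * l ^ 2 <= 1 * l ^ 2)
        by (apply Rmult_le_compat_r; lra). nra. }
    assert (l ^ S n * l <= l * l) by (apply Rmult_le_compat_r; lra). lra. }
  assert (HD0 : forall n, D n <> 0) by (intros n; specialize (HD n); lra).
  destruct (course_of_values 1 (fun n b =>
    - (l * sum_f_R0 (fun k => ((l ^ 2) ^ k * l ^ 2 - beta) * b k
                              * (l ^ (n - k) * b (n - k)%nat)) n) / D n))
    as [b [Hb0 Hb]].
  { intros n f g Hfg. do 3 f_equal. apply sum_eq. intros k Hk.
    now rewrite !Hfg by lia. }
  assert (HbD : forall n, D n * b (S n) =
    - (l * sum_f_R0 (fun k => ((l ^ 2) ^ k * l ^ 2 - beta) * b k
                              * (l ^ (n - k) * b (n - k)%nat)) n)).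
  { intros n. rewrite Hb. field. apply HD0. }
  destruct (CV_radius_quadratic_recursion b (/ (1 - l))) as [r [Hr0 Hr]].
  { apply Rinv_0_lt_compat. lra. }
  (* The factor [l] of the quadratic term cancels against the lower bound [l * (1 - l)] for the
     absolute value of [D n], which leaves [/ (1 - l)]. *)
  { intros n. apply Rmult_le_reg_l with (l * (1 - l)); [easy|].
    apply Rle_trans with (Rabs (D n * b (S n))).
    { rewrite Rabs_mult. apply Rmult_le_compat_r; [apply Rabs_pos|].
      rewrite <- Rabs_Ropp. apply Rle_trans with (2 := Rle_abs _).
      specialize (HD n). lra. }
    rewrite HbD, Rabs_Ropp, Rabs_mult, (Rabs_pos_eq l) by lra.
    rewrite <- Rmult_assoc, (Rmult_assoc l), Rinv_r, Rmult_1_r by lra.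
    apply Rmult_le_compat_l; [lra|].
    apply Rle_trans with (1 := Rsum_abs _ _). apply sum_Rle. intros k Hk.
    rewrite !Rabs_mult.
    assert (H1 := Hmul k).
    assert (H2 : Rabs (l ^ (n - k)) <= 1).
    { pose proof (pow_unit_interval l (n - k) ltac:(lra)). rewrite Rabs_pos_eq; lra. }
    apply Rmult_le_compat; try apply Rmult_le_pos; try apply Rabs_pos.
    - rewrite <- (Rmult_1_l (Rabs (b k))) at 2.
      apply Rmult_le_compat_r; [apply Rabs_pos|easy].
    - rewrite <- (Rmult_1_l (Rabs (b (n - k)%nat))) at 2.
      apply Rmult_le_compat_r; [apply Rabs_pos|easy]. }
  exists b, r. split; [easy|]. split; [easy|]. split; [easy|].
  split.
  { pose proof (HbD O) as H. unfold D in H. simpl sum_f_R0 in H.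
    rewrite Hb0 in H. simpl in H. simpl. rewrite <- Rminus_0_r.
    transitivity (- (l * ((1 * (l * (l * 1)) - beta) * 1 * (1 * 1)))); [|ring].
    rewrite <- H. ring. }
  split.
  { pose proof (HbD 1%nat) as H. unfold D in H. simpl sum_f_R0 in H.
    rewrite Hb0 in H. simpl in H.
    match type of H with _ = ?A => transitivity A end; [|ring].
    rewrite <- H. ring. }
  intros t Ht.
  assert (Htb : Rbar_lt (Rabs t) (CV_radius b)) by now apply Rbar_lt_trans with r.
  set (b2 := fun n => (l ^ 2) ^ n * b n).
  set (b1 := fun n => l ^ n * b n).
  assert (Ht2 : Rbar_lt (Rabs t) (CV_radius b2)).
  { apply Rbar_lt_le_trans with (1 := Htb), CV_radius_multiplier. intros n.
    pose proof (pow_unit_interval (l ^ 2) n ltac:(lra)). rewrite Rabs_pos_eq; lra. }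
  assert (Ht1 : Rbar_lt (Rabs t) (CV_radius b1)).
  { apply Rbar_lt_le_trans with (1 := Htb), CV_radius_multiplier. intros n.
    pose proof (pow_unit_interval l n ltac:(lra)). rewrite Rabs_pos_eq; lra. }
  rewrite <- (PSeries_scal_arg b (l ^ 2) t), <- (PSeries_scal_arg b l t).
  fold b1 b2.
  set (A := PS_plus (V := R_NormedModule) (PS_scal (l ^ 2) b2) (PS_scal (- beta) b)).
  assert (HexS : forall c (f : nat -> R), ex_pseries f t -> ex_pseries (PS_scal c f) t).
  { intros c f. apply ex_pseries_scal, Rmult_comm. }
  assert (Hexb : ex_pseries b t) by now apply CV_radius_inside.
  assert (Hexb1 : ex_pseries b1 t) by now apply CV_radius_inside.
  assert (Hexb2 : ex_pseries b2 t) by now apply CV_radius_inside.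
  assert (HA : PSeries A t = l ^ 2 * PSeries b2 t - beta * PSeries b t).
  { unfold A. rewrite PSeries_plus, !PSeries_scal by auto. ring. }
  assert (HtA : Rbar_lt (Rabs t) (CV_radius A)).
  { rewrite (CV_radius_ext A (fun n => ((l ^ 2) ^ n * l ^ 2 - beta) * b n)).
    - now apply Rbar_lt_le_trans with (1 := Htb), CV_radius_multiplier.
    - intros n. change (l ^ 2 * b2 n + - beta * b n
        = ((l ^ 2) ^ n * l ^ 2 - beta) * b n). unfold b2. ring. }
  (* The identity is checked coefficient by coefficient: the constant one vanishes by the
     characteristic equation, and the one of index [S n] is the recursion for [D n * b (S n)]. *)
  assert (Hlin : PSeries (PS_plus (PS_plus (PS_scal (X * l ^ 2) b2) (PS_scal l b1))
      (PS_scal (- (beta * X + 1)) b)) t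
    = t * (- (l * (PSeries A t * PSeries b1 t)))).
  { rewrite <- PSeries_mult by easy.
    rewrite <- (PSeries_scal l), <- PSeries_opp, <- PSeries_incr_1.
    apply PSeries_ext. intros [|n].
    - unfold PS_plus, PS_scal, PS_incr_1, b2, b1, plus, scal, zero. simpl.
      unfold mult. simpl. rewrite Hb0. rewrite Heq. ring.
    - change (X * l ^ 2 * b2 (S n) + l * b1 (S n) + - (beta * X + 1) * b (S n)
        = - (l * PS_mult A b1 n)).
      rewrite Heq. unfold b2, b1. transitivity (D n * b (S n)).
      { unfold D. ring. }
      rewrite HbD. do 2 f_equal. apply sum_eq. intros k Hk.
      change (A k) with (l ^ 2 * b2 k + - beta * b k). unfold b1, b2. ring. }
  rewrite !PSeries_plus, !PSeries_scal in Hlin by auto using ex_pseries_plus.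
  rewrite HA in Hlin.
  transitivity (X * l ^ 2 * PSeries b2 t + l * PSeries b1 t +
   - (beta * X + 1) * PSeries b t - t *
   - (l * ((l ^ 2 * PSeries b2 t - beta * PSeries b t) * PSeries b1 t))); [ring|].
  rewrite Hlin. ring.
Qed.

(** Here [u t = t * v t] with [v] the series just found, and [rem] is the tail of [v] after three
    terms. The last conclusion is the recurrence with its denominator cleared, at the parameters
    [t], [l * t], [l ^ 2 * t]; the value of [alpha] cancels its constant term. *)
Lemma stable_curve (alpha beta X l : R) : 0 < X -> 0 < l < 1 -> 0 <= beta <= 1 ->
  beta * X + 1 = X * l ^ 2 + l -> alpha = X * (1 - beta) - 1 ->
  exists (u rem : R -> R) (a2 a3 r : R), 0 < r /\
    (forall n, differentiable_upto n (fun t => Rabs (t - 0) < r) u) /\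
    is_derive u 0 1 /\ continuous rem 0 /\
    (X * (l ^ 4 - l ^ 2) + (l ^ 2 - l)) * a2 = - (l * (l ^ 2 - beta)) /\
    (X * (l ^ 6 - l ^ 2) + (l ^ 3 - l)) * a3 =
      - (l * (l * (l ^ 2 - beta) + (l ^ 4 - beta)) * a2) /\
    (forall t, Rabs (t - 0) < r ->
      u t = t + a2 * t ^ 2 + a3 * t ^ 3 + t ^ 4 * rem t) /\
    (forall t, Rabs (t - 0) < r ->
      (X + u (l ^ 2 * t)) * (X + u (l * t)) =
      alpha * (X + u (l * t)) + beta * (X + u t) * (X + u (l * t)) + (X + u t)).
Proof.
  intros HX Hl Hbeta Heq Halpha.
  destruct (stable_series X l beta HX Hl Hbeta Heq)
    as [b [r [Hr [Hrb [Hb0 [Hb1 [Hb2 Hfun]]]]]]].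
  exists (fun t => t * PSeries b t), (PSeries (PS_decr_n b 3)), (b 1%nat), (b 2%nat), r.
  split; [exact Hr|]. split.
  { intros n. apply differentiable_upto_mult; [apply differentiable_upto_id|].
    apply differentiable_upto_subset with (fun t => Rabs t < r).
    - intros t. now rewrite Rminus_0_r.
    - apply differentiable_upto_PSeries. now apply Rbar_lt_le. }
  assert (H0b : Rbar_lt (Rabs 0) (CV_radius b))
    by (rewrite Rabs_R0; now apply Rbar_lt_trans with r).
  split.
  { assert (Hb : ex_derive (PSeries b) 0) by now apply ex_derive_PSeries.
    auto_derive; [easy|]. rewrite PSeries_0, Hb0. ring. }
  split.
  { apply continuity_pt_filterlim, PSeries_continuity.
    unfold PS_decr_n.
    change (fun n => b (3 + n)%nat) with (PS_decr_1 (PS_decr_1 (PS_decr_1 b))).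
    now rewrite !CV_radius_decr_1. }
  split; [exact Hb1|]. split; [exact Hb2|]. split.
  - intros t. rewrite Rminus_0_r. intros Ht.
    rewrite (PSeries_decr_n b 2).
    + simpl sum_f_R0. rewrite Hb0. ring.
    + apply CV_radius_inside. now apply Rbar_lt_trans with r.
  - intros t. rewrite Rminus_0_r. intros Ht. specialize (Hfun t Ht).
    rewrite Halpha.
    apply Rminus_diag_uniq.
    match type of Hfun with ?A = 0 => transitivity (t * A) end; [ring|].
    rewrite Hfun. ring.
Qed.

(** * The local stable manifold *)

Lemma expanding_bounded_zero (e : nat -> R) (mu M : R) : 1 < mu ->
  (forall n, Rabs (e n) <= M) ->
  (forall n, mu * Rabs (e n) <= Rabs (e (S n))) -> e O = 0.
Proof.
  intros Hmu HM He.
  destruct (Req_dec (e O) 0) as [|Hne]; [easy|exfalso].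
  pose proof (Rabs_pos_lt _ Hne) as Hpos.
  assert (Hgrow : forall n, mu ^ n * Rabs (e O) <= Rabs (e n)).
  { induction n as [|n IH]; [simpl; lra|].
    apply Rle_trans with (2 := He n). simpl. rewrite Rmult_assoc.
    apply Rmult_le_compat_l; lra. }
  destruct (Pow_x_infinity mu ltac:(rewrite Rabs_pos_eq; lra) ((M + 1) / Rabs (e O)))
    as [N HN].
  specialize (HN N (le_n N)). rewrite Rabs_pos_eq in HN by (apply pow_le; lra).
  specialize (Hgrow N). specialize (HM N).
  assert (H : (M + 1) / Rabs (e O) * Rabs (e O) <= mu ^ N * Rabs (e O))
    by (apply Rmult_le_compat_r; lra).
  replace ((M + 1) / Rabs (e O) * Rabs (e O)) with (M + 1) in H by (field; lra).
  lra.
Qed.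

Lemma locally_pair (a b : R) (P Q : R -> Prop) : locally a P -> locally b Q ->
  locally (a, b) (fun q => P (fst q) /\ Q (snd q)).
Proof.
  intros [d1 H1] [d2 H2].
  exists (mkposreal _ (Rmin_stable_in_posreal d1 d2)).
  intros [x y] [Hx Hy]. split.
  - apply H1. apply ball_le with (2 := Hx). apply Rmin_l.
  - apply H2. apply ball_le with (2 := Hy). apply Rmin_r.
Qed.

Lemma is_derive_affine_arg (u : R -> R) (X c : R) : is_derive u 0 1 ->
  is_derive (fun t => X + u (c * t)) 0 c.
Proof.
  intros Hu. assert (Hu' : is_derive u (c * 0) 1) by now rewrite Rmult_0_r.
  auto_derive; [now exists 1|].
  change (fun x => u x) with u. rewrite (is_derive_unique _ _ _ Hu'). ring.
Qed.

Lemma contraction_Rabs (l t d : R) : 0 <= l <= 1 -> Rabs (t - 0) < d ->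
  Rabs (l * t - 0) < d.
Proof.
  rewrite !Rminus_0_r, Rabs_mult. intros Hl Ht. rewrite (Rabs_pos_eq l) by easy.
  pose proof (Rabs_pos t). nra.
Qed.

(* If [t] parametrizes the curve, so that the map acts on it as [t |-> l * t],
   then the horizontal distance [x - sigma y] to the curve is multiplied by about
   [(beta + 1 / X) / l > 1] at each step; an orbit staying near the fixed point
   therefore lies on the curve. *)
Lemma curve_is_stable_manifold (alpha beta X l r : R) (u : R -> R) :
  1 < X -> 0 < l < 1 -> l < beta + / X -> 0 < r ->
  (forall n, differentiable_upto n (fun t => Rabs (t - 0) < r) u) ->
  u 0 = 0 -> is_derive u 0 1 ->
  (forall t, Rabs (t - 0) < r ->
      (X + u (l ^ 2 * t)) * (X + u (l * t)) =
      alpha * (X + u (l * t)) + beta * (X + u t) * (X + u (l * t)) + (X + u t)) ->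
  exists (tau : R -> R) (L : R), 0 <= L /\
    locally X (fun y => X + u (l * tau y) = y /\ Rabs (tau y) <= L * Rabs (y - X)) /\
    smooth_near (fun y => X + u (tau y)) X /\
    stable_manifold_is_graph (planar_map alpha beta) (X, X) (fun y => X + u (tau y)).
Proof.
  intros HX Hl Hk Hr Hu Hu0 Hdu Hfun.
  set (U := fun t => Rabs (t - 0) < r) in *.
  (* [q] is the height of the curve at parameter [t]; its local inverse [tau] recovers the parameter
     from the height. *)
  set (q := fun t => X + u (l * t)).
  assert (HU : open U) by apply open_Rabs_lt.
  assert (HU0 : U 0) by (unfold U; rewrite Rminus_diag, Rabs_R0; easy).
  assert (Hq : forall n, differentiable_upto n U q).
  { intros n. apply differentiable_upto_plus; [apply differentiable_upto_const|].
    apply differentiable_upto_comp with U; [|apply Hu|].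
    - intros t. apply contraction_Rabs. lra.
    - apply differentiable_upto_mult;
        [apply differentiable_upto_const|apply differentiable_upto_id]. }
  assert (Hdq : is_derive q 0 l) by now apply is_derive_affine_arg.
  assert (Hq0 : q 0 = X) by (unfold q; rewrite Rmult_0_r, Hu0; ring).
  destruct (local_inverse U q 0 l HU HU0 Hq Hdq ltac:(lra))
    as [tau [V [HV [HV0 [Htau [Htau2 [Hsm [L [HL HLip]]]]]]]]].
  rewrite Hq0 in HV0.
  assert (Htau0 : tau X = 0).
  { pose proof (locally_singleton _ _ Htau2) as H. simpl in H. now rewrite Hq0 in H. }
  exists tau, L. split; [exact HL|].
  assert (HLoc : locally X (fun y => X + u (l * tau y) = y /\
                                      Rabs (tau y) <= L * Rabs (y - X))).
  { generalize (HV X HV0). apply filter_imp. intros y Hy. split; [now apply Htau|].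
    specialize (HLip X y HV0 Hy). now rewrite Htau0, Rminus_0_r in HLip. }
  split; [exact HLoc|].
  set (sigma := fun y => X + u (tau y)).
  assert (Hsig : forall n, differentiable_upto n V sigma).
  { intros n. apply differentiable_upto_plus; [apply differentiable_upto_const|].
    apply differentiable_upto_comp with U; [|apply Hu|apply Hsm].
    intros y Hy. now apply Htau. }
  split; [now apply smooth_near_of_differentiable_upto with V|].
  assert (Hcu : continuous u 0) by now apply differentiable_upto_continuous with O U.
  assert (Hcq : continuous q 0) by now apply differentiable_upto_continuous with O U.
  assert (Hct : continuous tau X) by now apply differentiable_upto_continuous with O V.
  set (k := (l + (beta + / X)) / 2).
  (* This value makes [(1 - eps) * k - (l + eps)] equal to [(k - l) / 2], so the expansion factor
     [(1 - eps) * k / (l + eps)] exceeds 1. *)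
  set (eps := (k - l) / (2 * (1 + k))).
  assert (Hkl : l < k < beta + / X) by (unfold k; lra).
  assert (Heps : 0 < eps) by (apply Rdiv_lt_0_compat; lra).
  assert (Heps2 : l + eps < (1 - eps) * k).
  { apply Rlt_0_minus. replace ((1 - eps) * k - (l + eps)) with ((k - l) / 2).
    - lra.
    - unfold eps. field. lra. }
  assert (Heps1 : 0 < 1 - eps) by nra.
  destruct (strict_derivative u (Derive u) 0 eps) as [d1 [Hd1 Hs1]].
  { generalize (HU 0 HU0). apply filter_imp. intros t.
    now apply differentiable_upto_is_derive with O. }
  { apply differentiable_upto_continuous with O U; [|easy].
    now apply differentiable_upto_Derive. }
  { exact Heps. }
  destruct (strict_derivative q (Derive q) 0 eps) as [d2 [Hd2 Hs2]].
  { generalize (HU 0 HU0). apply filter_imp. intros t.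
    now apply differentiable_upto_is_derive with O. }
  { apply differentiable_upto_continuous with O U; [|easy].
    now apply differentiable_upto_Derive. }
  { exact Heps. }
  rewrite (is_derive_unique _ _ _ Hdu) in Hs1.
  rewrite (is_derive_unique _ _ _ Hdq) in Hs2.
  set (P := fun t => (X + u t, q t)).
  set (F := planar_map alpha beta).
  assert (HP : locally 0 (fun t => F (P t) = P (l * t))).
  { generalize (filter_and _ _ (HU 0 HU0)
      (continuous_locally_Rabs q 0 X X Hcq Hq0 ltac:(lra))).
    apply filter_imp. intros t [Ht Hqt].
    apply Rabs_def2 in Hqt. unfold F, planar_map, P. simpl.
    f_equal. specialize (Hfun t Ht). unfold q in *.
    replace (l * (l * t)) with (l ^ 2 * t) by ring.
    apply Rmult_eq_reg_r with (X + u (l * t)); [|lra].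
    rewrite Hfun. field. lra. }
  destruct (locally_Rabs_inv _ _ HP) as [d3 [Hd3 HP3]].
  (* These are conditions on the height alone: [tau] inverts [q] there, the parameter lies in the
     range of the three local estimates, and the curve stays within distance 1 of [X] with vertical
     expansion rate above [k]. *)
  set (G := fun y =>
    (V y /\ V (q (l * tau y)) /\ tau (q (l * tau y)) = l * tau y) /\
    (Rabs (tau y - 0) < d1 /\ Rabs (tau y - 0) < d2 /\ Rabs (tau y - 0) < d3) /\
    (Rabs (sigma y - X) < 1 /\ 0 < y /\ k < beta + / y)).
  assert (HG : locally X G).
  { assert (Hlt : filterlim (fun y => l * tau y) (locally X) (locally 0)).
    { replace 0 with (l * tau X) by (rewrite Htau0; ring).
      apply (continuous_scal_r l tau X Hct). }
    assert (Hqlt : filterlim (fun y => q (l * tau y)) (locally X) (locally X)).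
    { apply filterlim_comp with (locally 0); [exact Hlt|].
      pose proof Hcq as H. unfold continuous in H. now rewrite Hq0 in H. }
    assert (Ht0 : forall d, 0 < d -> locally X (fun y => Rabs (tau y - 0) < d)).
    { intros d Hd. now apply continuous_locally_Rabs. }
    repeat apply filter_and; try (now apply Ht0).
    - now apply HV.
    - apply (Hqlt V). now apply HV.
    - apply (Hlt (fun s => tau (q s) = s)). exact Htau2.
    - assert (Hs0 : sigma X = X) by (unfold sigma; rewrite Htau0, Hu0; ring).
      apply continuous_locally_Rabs; [|easy|lra].
      now apply differentiable_upto_continuous with O V.
    - apply open_gt. lra.
    - assert (Hinv : continuous (fun y => / y) X).
      { apply continuous_Rinv. lra. }
      generalize (continuous_locally_Rabs _ _ _ (beta + / X - k) Hinv eq_refl ltac:(lra)).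
      apply filter_imp. intros y Hy. apply Rabs_def2 in Hy. lra. }
  (* Since [1 < X], the radius 1 keeps the first coordinate positive. *)
  exists (fun p => Rabs (fst p - X) < 1 /\ G (snd p)).
  split. { apply (locally_pair X X (fun x => Rabs (x - X) < 1) G); [apply locally_Rabs; lra|exact HG]. }
  split.
  { intros [x y] [Hx HGy]. simpl in *. apply Rabs_def2 in Hx.
    destruct HGy as [_ [_ [_ [Hy _]]]]. lra. }
  intros N HN HN0.
  assert (Hgraph : forall p, (forall n, N (Nat.iter n F p)) ->
    fst p = sigma (snd p)).
  { intros p Hp. apply Rminus_diag_uniq.
    set (e := fun n => fst (Nat.iter n F p) - sigma (snd (Nat.iter n F p))).
    (* The bound 2 arises because the first coordinate and the value of [sigma] both lie within 1 of
       [X]. *)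
    apply (expanding_bounded_zero e ((1 - eps) * k / (l + eps)) 2).
    - apply Rmult_lt_reg_r with (l + eps); [lra|].
      replace ((1 - eps) * k / (l + eps) * (l + eps)) with ((1 - eps) * k)
        by (field; lra). lra.
    - intros n. destruct (HN0 _ (Hp n)) as [Hx [_ [_ [Hsy _]]]].
      unfold e. apply Rabs_def2 in Hx, Hsy. apply Rabs_le. lra.
    - intros n. pose proof (HN0 _ (Hp n)) as Hn. pose proof (HN0 _ (Hp (S n))) as Hn1.
      unfold e. simpl Nat.iter in *. destruct (Nat.iter n F p) as [x y].
      unfold F, planar_map in Hn1 |- *. simpl in *.
      destruct Hn as [_ [[Vy [VA HtA]] [[Ht1 [Ht2 Ht3]] [_ [Hy Hky]]]]].
      set (B := alpha + beta * x + x / y) in *.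
      destruct Hn1 as [_ [[VB _] [[HB1 [HB2 _]] _]]].
      destruct (Htau y Vy) as [_ Hqy]. destruct (Htau B VB) as [_ HqB].
      pose proof (HP3 _ Ht3) as HPt. unfold F, P, planar_map in HPt. simpl in HPt.
      rewrite Hqy in HPt. fold (sigma y) in HPt.
      injection HPt as _ HA.
      (* The points [(x, y)] and [(sigma y, y)] have the same height, so the heights of their images
         differ by exactly this amount. *)
      assert (HAB : q (l * tau y) - B = (beta + / y) * (sigma y - x)).
      { rewrite <- HA. unfold B. field. lra. }
      assert (H1 : Rabs (u (tau B) - u (l * tau y) - 1 * (tau B - l * tau y))
        <= eps * Rabs (tau B - l * tau y)).
      { apply Hs1; [|easy]. apply contraction_Rabs; [lra|easy]. }
      assert (H2 : Rabs (q (tau B) - q (l * tau y) - l * (tau B - l * tau y))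
        <= eps * Rabs (tau B - l * tau y)).
      { apply Hs2; [|easy]. apply contraction_Rabs; [lra|easy]. }
      (* [D] is the parameter gap between the curve point at height [B] and the image of the curve
         point at height [y]. As [q] has slope about [l] and [u] slope about 1, the vertical gap is
         at most [(l + eps) * Rabs D] and the new horizontal gap at least [(1 - eps) * Rabs D]. *)
      set (D := tau B - l * tau y) in *.
      rewrite HqB in H2.
      assert (H3 : Rabs (y - sigma B) = Rabs (u (tau B) - u (l * tau y))).
      { rewrite Rabs_minus_sym. f_equal. unfold sigma. unfold q in Hqy. lra. }
      rewrite H3.
      assert (H4 : k * Rabs (x - sigma y) <= Rabs (B - q (l * tau y))).
      { rewrite (Rabs_minus_sym B), HAB, Rabs_mult, (Rabs_minus_sym x).
        apply Rmult_le_compat_r; [apply Rabs_pos|].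
        apply Rle_trans with (2 := Rle_abs _). lra. }
      assert (H5 : Rabs (B - q (l * tau y)) <= (l + eps) * Rabs D).
      { replace (B - q (l * tau y)) with ((B - q (l * tau y) - l * D) + l * D) by ring.
        apply Rle_trans with (1 := Rabs_triang _ _).
        rewrite (Rabs_mult l), (Rabs_pos_eq l) by lra. lra. }
      assert (H6 : (1 - eps) * Rabs D <= Rabs (u (tau B) - u (l * tau y))).
      { assert (H : Rabs D <= Rabs (u (tau B) - u (l * tau y)) +
          Rabs (u (tau B) - u (l * tau y) - 1 * D)).
        { replace D with ((u (tau B) - u (l * tau y)) +
            - (u (tau B) - u (l * tau y) - 1 * D)) at 1 by ring.
          rewrite <- (Rabs_Ropp (u (tau B) - u (l * tau y) - 1 * D)).
          apply Rabs_triang. }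
        lra. }
      apply Rmult_le_reg_l with (l + eps); [lra|].
      replace ((l + eps) * ((1 - eps) * k / (l + eps) * Rabs (x - sigma y)))
        with ((1 - eps) * (k * Rabs (x - sigma y))) by (field; lra).
      apply Rle_trans with ((1 - eps) * ((l + eps) * Rabs D)).
      + apply Rmult_le_compat_l; lra.
      + replace ((1 - eps) * ((l + eps) * Rabs D)) with
          ((l + eps) * ((1 - eps) * Rabs D)) by ring.
        apply Rmult_le_compat_l; lra. }
  assert (HcP : filterlim P (locally 0) (locally (X, X))).
  { intros Q [d HQ].
    change (locally 0 (fun t => Q (P t))).
    generalize (filter_and _ _
      (continuous_locally_Rabs u 0 0 d Hcu Hu0 (cond_pos d))
      (continuous_locally_Rabs q 0 X d Hcq Hq0 (cond_pos d))).
    apply filter_imp. intros t [H1 H2]. apply HQ. split.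
    - change (Rabs (X + u t - X) < d).
      now replace (X + u t - X) with (u t - 0) by ring.
    - exact H2. }
  (* The parameter interval of radius [d4] is stable under multiplication by [l], so forward orbits
     starting on this piece of the curve remain in [N]. *)
  destruct (locally_Rabs_inv _ _ (filter_and _ _ HP (HcP N HN))) as [d4 [Hd4 H4]].
  assert (Hloc : locally X (fun y => V y /\ Rabs (tau y - 0) < d4)).
  { apply filter_and; [now apply HV|].
    now apply continuous_locally_Rabs. }
  generalize (locally_pair X X (fun _ => True) _ filter_true Hloc).
  apply filter_imp. intros [x y] [_ [HVy Hty]].
  change R in x, y. simpl in HVy, Hty |- *.
  split; [intros [_ [H _]]; now apply (Hgraph (x, y))|].
  intros Hx.
  assert (Hxy : (x, y) = P (tau y)).
  { unfold P. rewrite Hx. destruct (Htau y HVy) as [_ ->]. reflexivity. }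
  assert (Hpow : forall n, Rabs (l ^ n * tau y - 0) < d4).
  { intros n. apply contraction_Rabs; [|easy]. apply pow_unit_interval. lra. }
  assert (Hiter : forall n, Nat.iter n F (x, y) = P (l ^ n * tau y)).
  { intros n. induction n as [|n IH].
    - simpl. rewrite Rmult_1_l. exact Hxy.
    - change (F (Nat.iter n F (x, y)) = P (l ^ S n * tau y)). rewrite IH. destruct (H4 _ (Hpow n)) as [-> _].
      simpl pow. now rewrite Rmult_assoc. }
  split.
  { rewrite Hxy. now apply H4. }
  split.
  - intros n. rewrite Hiter. now apply H4.
  - apply filterlim_ext with (fun n => P (l ^ n * tau y)).
    { intros n. symmetry. apply Hiter. }
    apply filterlim_comp with (2 := HcP).
    (* The limit of a scaled sequence is stated with [Rbar_mult], so [0] is first put in that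
       form. *)
    replace (locally 0) with (Rbar_locally (Rbar_mult 0 (tau y)))
      by (simpl; now rewrite Rmult_0_l).
    apply (is_lim_seq_scal_r (fun n => l ^ n) (tau y) 0).
    apply is_lim_seq_geom. rewrite Rabs_pos_eq; lra.
Qed.

(** * The cubic [S] *)

(* As [c2 + c3 = 1], the equation [S = 0] reads
   [w - b * w ^ 2 + c * w ^ 3 = - (y - X)], which is solved for [w]. *)
Lemma cubic_implicit_function (X c1 c2 c3 b c : R) : c1 <> 0 -> c2 + c3 = 1 ->
  let w x y := c1 * (x - X) - c2 * (y - X) in
  let S x y := c1 * (x - X) + c3 * (y - X) - b * w x y ^ 2 + c * w x y ^ 3 in
  exists psi : R -> R, smooth_near psi X /\ psi X = X /\
    locally X (fun y => S (psi y) y = 0) /\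
    exists M d, 0 < d /\ forall x y, Rabs (x - X) < d -> Rabs (y - X) < d ->
      Rabs (x - psi y) <= M * Rabs (S x y).
Proof.
  intros Hc1 Hc w S.
  set (h := fun z => z + z * z * (- b + c * z)).
  assert (Hh : forall n, differentiable_upto n (fun _ => True) h).
  { intros n. unfold h.
    repeat first [apply differentiable_upto_id | apply differentiable_upto_const
      | apply differentiable_upto_plus | apply differentiable_upto_mult]. }
  assert (Hdh : is_derive h 0 1).
  { unfold h. auto_derive; [easy|ring]. }
  assert (Hh0 : h 0 = 0) by (unfold h; ring).
  destruct (local_inverse (fun _ => True) h 0 1 open_true I Hh Hdh Rlt_0_1)
    as [g [V [HV [HV0 [Hg [Hg2 [Hsm [L [HL HLip]]]]]]]]].
  rewrite Hh0 in HV0.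
  assert (Hg0 : g 0 = 0).
  { pose proof (locally_singleton _ _ Hg2) as H. simpl in H. now rewrite Hh0 in H. }
  destruct (locally_Rabs_inv 0 V (HV 0 HV0)) as [d1 [Hd1 HV1]].
  assert (HhV : locally 0 (fun z => V (h z))).
  { assert (Hch : continuous h 0)
      by (apply (ex_derive_continuous h 0); now exists 1).
    generalize (continuous_locally_Rabs h 0 0 d1 Hch Hh0 Hd1).
    apply filter_imp. intros z. apply HV1. }
  destruct (locally_Rabs_inv _ _ (filter_and _ _ HhV Hg2)) as [d2 [Hd2 Hz]].
  (* This solves [w x y = g (X - y)] for [x], where [g] inverts [h]. The form [X + -1 * y] fits the
     closure lemmas for sums and products. *)
  set (psi := fun y => X + / c1 * (g (X + -1 * y) + c2 * (y + - X))).
  assert (HS : forall x y, S x y = h (w x y) + (y - X)).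
  { intros x y. unfold S, h, w. replace c3 with (1 - c2) by lra. ring. }
  assert (Hw : forall y, w (psi y) y = g (X + -1 * y)).
  { intros y. unfold w, psi. field. easy. }
  set (U := fun y => Rabs (y - X) < d1).
  assert (HUV : forall y, U y -> V (X + -1 * y)).
  { intros y Hy. apply HV1. rewrite <- Rabs_Ropp.
    now replace (- (X + -1 * y - 0)) with (y - X) by ring. }
  exists psi. split.
  { apply smooth_near_of_differentiable_upto with U.
    - apply open_Rabs_lt.
    - unfold U. now rewrite Rminus_diag, Rabs_R0.
    - intros n.
      repeat first [apply differentiable_upto_id | apply differentiable_upto_const
        | apply differentiable_upto_plus | apply differentiable_upto_mult
        | apply differentiable_upto_comp with (1 := HUV) (2 := Hsm n)]. }
  split.
  { unfold psi. replace (X + -1 * X) with 0 by ring. rewrite Hg0. ring. }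
  split.
  { generalize (locally_Rabs X d1 Hd1). apply filter_imp. intros y Hy.
    rewrite HS, Hw. destruct (Hg _ (HUV y Hy)) as [_ ->]. ring. }
  (* If [x] and [y] are within [d2 / m] of [X], then [w x y] is smaller than [d2] in absolute
     value. *)
  set (m := Rabs c1 + Rabs c2 + 1).
  assert (Hm : 1 <= m).
  { unfold m. generalize (Rabs_pos c1) (Rabs_pos c2). lra. }
  exists (L * / Rabs c1), (Rmin d1 (d2 / m)). split.
  { apply Rmin_pos; [easy|]. apply Rdiv_lt_0_compat; lra. }
  intros x y Hx Hy.
  assert (Hwd : Rabs (w x y - 0) < d2).
  { assert (Hx2 := Rlt_le_trans _ _ _ Hx (Rmin_r _ _)).
    assert (Hy2 := Rlt_le_trans _ _ _ Hy (Rmin_r _ _)).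
    set (e := d2 / m) in *. assert (He : d2 = m * e) by (unfold e; field; lra).
    assert (0 < e) by (apply Rdiv_lt_0_compat; lra).
    rewrite Rminus_0_r, He. unfold w, Rminus at 1.
    apply Rle_lt_trans with (1 := Rabs_triang _ _).
    rewrite Rabs_Ropp, !Rabs_mult.
    assert (Rabs c1 * Rabs (x - X) <= Rabs c1 * e)
      by (apply Rmult_le_compat_l; [apply Rabs_pos|lra]).
    assert (Rabs c2 * Rabs (y - X) <= Rabs c2 * e)
      by (apply Rmult_le_compat_l; [apply Rabs_pos|lra]).
    unfold m. lra. }
  destruct (Hz _ Hwd) as [HVw Hgw].
  assert (HVy := HUV y (Rlt_le_trans _ _ _ Hy (Rmin_l _ _))).
  specialize (HLip _ _ HVy HVw). rewrite Hgw in HLip.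
  (* The value [S x y] is the gap between the arguments [h (w x y)] and [X - y] of [g], so the
     Lipschitz bound controls the gap in [w], hence in [x]. *)
  replace (h (w x y) - (X + -1 * y)) with (S x y) in HLip by (rewrite HS; ring).
  replace (x - psi y) with (/ c1 * (w x y - g (X + -1 * y)))
    by (unfold w, psi; field; easy).
  rewrite Rabs_mult, Rabs_inv.
  apply Rle_trans with (/ Rabs c1 * (L * Rabs (S x y))); [|right; ring].
  apply Rmult_le_compat_l; [|easy].
  apply Rlt_le, Rinv_0_lt_compat. now apply Rabs_pos_lt.
Qed.

(** The three equations that follow [c2 + c3 = 1] annihilate the coefficients of [t], [t ^ 2] and
    [t ^ 3] in [S] along the curve. What remains is [t ^ 4] times a function continuous at 0. *)
Lemma cubic_contact (X l c1 c2 c3 b c a2 a3 r : R) (u rem : R -> R) :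
  0 < r -> 0 < l < 1 -> continuous rem 0 ->
  (forall t, Rabs (t - 0) < r ->
      u t = t + a2 * t ^ 2 + a3 * t ^ 3 + t ^ 4 * rem t) ->
  c2 + c3 = 1 -> c1 + c3 * l = 0 -> (c1 + c3 * l ^ 2) * a2 = b * l ^ 2 ->
  (c1 + c3 * l ^ 3) * a3 = - 2 * b * l * ((c1 - c2 * l ^ 2) * a2) + c * l ^ 3 ->
  let w x y := c1 * (x - X) - c2 * (y - X) in
  let S x y := c1 * (x - X) + c3 * (y - X) - b * w x y ^ 2 + c * w x y ^ 3 in
  exists K, 0 <= K /\
    locally 0 (fun t => Rabs (S (X + u t) (X + u (l * t))) <= K * Rabs t ^ 4).
Proof.
  intros Hr Hl Hrem Hu Hc H1 H2 H3 w S.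
  (* Successive tails of the expansion of [w] along the curve: [w = - l * t + t ^ 2 * v], then [v]
     has tail [H] and [H] has tail [R4]. *)
  set (R4 := fun t => c1 * rem t - c2 * l ^ 4 * rem (l * t)).
  set (H := fun t => (c1 - c2 * l ^ 3) * a3 + t * R4 t).
  set (v := fun t => (c1 - c2 * l ^ 2) * a2 + t * H t).
  set (Q := fun t => (c1 * rem t + c3 * l ^ 4 * rem (l * t))
    - b * (-2 * l * H t + v t * v t)
    + c * (3 * l ^ 2 * v t - 3 * l * t * (v t * v t) + t * t * (v t * v t * v t))).
  assert (HSQ : forall t, Rabs (t - 0) < r -> S (X + u t) (X + u (l * t)) = t ^ 4 * Q t).
  { intros t Ht.
    assert (Hlt : Rabs (l * t - 0) < r) by (apply contraction_Rabs; [lra|easy]).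
    assert (Hw : w (X + u t) (X + u (l * t)) = t * (- l + t * v t)).
    { unfold w. rewrite (Hu t Ht), (Hu _ Hlt). unfold v, H, R4.
      replace c1 with (- c3 * l) by lra. replace c3 with (1 - c2) by lra. ring. }
    unfold S. rewrite Hw, (Hu t Ht), (Hu _ Hlt). unfold Q.
    transitivity ((c1 + c3 * l) * t + ((c1 + c3 * l ^ 2) * a2) * t ^ 2
      + ((c1 + c3 * l ^ 3) * a3) * t ^ 3
      + t ^ 4 * (c1 * rem t + c3 * l ^ 4 * rem (l * t))
      - b * (t * (- l + t * v t)) ^ 2 + c * (t * (- l + t * v t)) ^ 3); [ring|].
    rewrite H1, H2, H3. unfold v at 1. ring_simplify. unfold v. ring. }
  assert (HcQ : continuous Q 0).
  { assert (Hreml : continuous (fun t => rem (l * t)) 0).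
    { apply (continuous_comp (fun t => l * t) rem).
      - apply (ex_derive_continuous (fun t => l * t)). now auto_derive.
      - now rewrite Rmult_0_r. }
    assert (Hplus : forall f g, continuous f 0 -> continuous g 0 ->
      continuous (fun t => f t + g t) 0)
      by (intros f g; apply (continuous_plus f g)).
    assert (Hminus : forall f g, continuous f 0 -> continuous g 0 ->
      continuous (fun t => f t - g t) 0)
      by (intros f g; apply (continuous_minus f g)).
    assert (Hmult : forall f g, continuous f 0 -> continuous g 0 ->
      continuous (fun t => f t * g t) 0)
      by (intros f g; apply (continuous_mult f g)).
    assert (Hconst : forall k : R, continuous (fun _ : R => k) 0)
      by (intros k; apply continuous_const).
    assert (Hid : continuous (fun t : R => t) 0) by apply continuous_id.
    assert (HR4 : continuous R4 0) by (unfold R4; auto 10).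
    assert (HH : continuous H 0) by (unfold H; auto 10).
    assert (Hv : continuous v 0) by (unfold v; auto 10).
    unfold Q. auto 20. }
  exists (Rabs (Q 0) + 1). split; [generalize (Rabs_pos (Q 0)); lra|].
  generalize (filter_and _ _ (locally_Rabs 0 r Hr)
    (continuous_locally_Rabs Q 0 (Q 0) 1 HcQ eq_refl Rlt_0_1)).
  apply filter_imp. intros t [Ht HQ].
  rewrite (HSQ t Ht), Rabs_mult, <- RPow_abs, Rmult_comm.
  apply Rmult_le_compat_r; [apply pow_le, Rabs_pos|].
  replace (Q t) with ((Q t - Q 0) + Q 0) by ring.
  apply Rle_trans with (1 := Rabs_triang _ _). lra.
Qed.

(** * ** Eigenvalues and the values of [b2] and [b3] *)

Lemma saddle_parameters (alpha beta : R) : 0 < alpha < 1 -> 0 <= beta < 1 ->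
  let X := xbar alpha beta in
  let l := lambda2 alpha beta in
  1 < X /\ 0 < l < 1 /\ l < beta + / X /\ beta * X + 1 = X * l ^ 2 + l /\
  alpha = X * (1 - beta) - 1 /\ theta alpha beta = 1 + 2 * X * l /\
  lambda1 alpha beta = - l - / X.
Proof.
  intros Ha Hb X l.
  assert (HXa : X * (1 - beta) = 1 + alpha) by (unfold X, xbar; field; lra).
  assert (HX : 1 < X) by nra.
  assert (Hth : theta alpha beta = 1 + 2 * X * l)
    by (unfold l, lambda2; fold X; field; lra).
  assert (Hth2 : theta alpha beta * theta alpha beta = 1 + 4 * X + 4 * beta * X ^ 2).
  { unfold theta. fold X. apply sqrt_sqrt.
    assert (0 <= beta * X ^ 2) by (apply Rmult_le_pos; [lra|apply pow_le; lra]). lra. }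
  assert (Hth0 : 0 <= theta alpha beta) by apply sqrt_pos.
  assert (HbX : 0 <= beta * X) by (apply Rmult_le_pos; lra).
  (* Squaring [theta = 1 + 2 * X * l] gives [4 * X] times the characteristic equation. *)
  assert (Hquad : beta * X + 1 = X * l ^ 2 + l).
  { rewrite Hth in Hth2. apply Rmult_eq_reg_l with (4 * X); [|lra]. simpl in *. lra. }
  assert (Hl1 : 0 < l).
  { assert (1 < theta alpha beta).
    { apply Rsqr_incrst_0; unfold Rsqr; try lra. rewrite Hth2.
      assert (0 <= beta * X * X) by (apply Rmult_le_pos; lra). simpl. lra. }
    apply Rmult_lt_reg_l with (2 * X); lra. }
  assert (Hl2 : l < 1).
  { apply Rnot_le_lt. intros Hge.
    assert (X * l <= X * l ^ 2) by (simpl; rewrite Rmult_1_r; nra).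
    assert (X <= X * l) by nra. lra. }
  repeat split; try lra.
  (* As [beta + / X] is minus the product of the eigenvalues, the claim says that [lambda1] has
     modulus above 1. Otherwise [X - alpha = beta * X + 1 <= X * l <= X - 1], against
     [alpha < 1]. *)
  - apply Rmult_lt_reg_l with X; [lra|].
    replace (X * (beta + / X)) with (beta * X + 1) by (field; lra).
    apply Rnot_le_lt. intros Hge.
    assert (Hge2 : X * l ^ 2 + l <= X * l) by lra.
    assert (Hl3 : X * l + 1 <= X).
    { apply Rmult_le_reg_l with l; [easy|]. simpl in Hge2. lra. }
    assert (Hxl : X * (X * l) <= X * (X - 1)) by (apply Rmult_le_compat_l; lra).
    nra.
  - unfold lambda1. rewrite Hth. fold X. field. lra.
Qed.

(** The conclusions are the hypotheses of [cubic_implicit_function] and [cubic_contact]. Once [beta]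
    is eliminated by the characteristic equation, all quantities are rational in [X] and [l], and
    the claims become identities of fractions. *)
Lemma S_poly_coefficients (alpha beta a2 a3 : R) :
  0 < alpha < 1 -> 0 <= beta < 1 ->
  let X := xbar alpha beta in
  let l := lambda2 alpha beta in
  let c1 := gamma1 alpha beta in
  let c2 := gamma2 alpha beta in
  let c3 := gamma3 alpha beta in
  (X * (l ^ 4 - l ^ 2) + (l ^ 2 - l)) * a2 = - (l * (l ^ 2 - beta)) ->
  (X * (l ^ 6 - l ^ 2) + (l ^ 3 - l)) * a3 =
    - (l * (l * (l ^ 2 - beta) + (l ^ 4 - beta)) * a2) ->
  c1 <> 0 /\ c2 + c3 = 1 /\ c1 + c3 * l = 0 /\
  (c1 + c3 * l ^ 2) * a2 = b2 alpha beta * l ^ 2 /\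
  (c1 + c3 * l ^ 3) * a3 = - 2 * b2 alpha beta * l * ((c1 - c2 * l ^ 2) * a2)
    + b3 alpha beta * l ^ 3.
Proof.
  intros Ha Hb X l c1 c2 c3 H2 H3.
  destruct (saddle_parameters alpha beta Ha Hb)
    as [HX [Hl [_ [Hq [_ [Hth Hl1]]]]]].
  fold X l in HX, Hl, Hq, Hth, Hl1.
  assert (Hbeta : beta = l ^ 2 + l / X - / X).
  { apply Rmult_eq_reg_r with X; [|lra].
    transitivity (X * l ^ 2 + l - 1); [lra|field; lra]. }
  assert (HXl : 0 < X * l) by nra.
  assert (Hl2 : 0 < l ^ 2) by (apply pow_lt; lra).
  assert (Hl3 : 0 < l ^ 3) by (apply pow_lt; lra).
  assert (HXl2 : 0 < X * l ^ 2) by nra.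
  assert (HXl3 : 0 < X * l ^ 3) by nra.
  assert (Hc1 : c1 = - (X * l ^ 2 + l) / (1 + 2 * X * l)).
  { unfold c1, gamma1. fold X. rewrite Hth, <- Hq. field. lra. }
  assert (Hc2 : c2 = X * l / (1 + 2 * X * l)).
  { unfold c2, gamma2. rewrite Hth. field. lra. }
  assert (Hc3 : c3 = (1 + X * l) / (1 + 2 * X * l)).
  { unfold c3, gamma3. rewrite Hth. field. lra. }
  (* These are the factors of the denominators; the multipliers of [a2] and [a3] also split into
     them. *)
  assert (Hl0 : l <> 0) by lra.
  assert (Hl1' : 1 - l <> 0) by lra.
  assert (Hl2' : 1 - l ^ 2 <> 0) by (apply Rgt_not_eq; nra).
  assert (Hd0 : 1 + 2 * X * l <> 0) by lra.
  assert (Hd1 : X * l * (1 + l) + 1 <> 0) by (apply Rgt_not_eq; nra).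
  assert (Hd2 : X * l * (1 + l ^ 2) + 1 <> 0) by (apply Rgt_not_eq; nra).
  assert (Ha2 : a2 = (l ^ 2 - beta) / ((1 - l) * (X * l * (1 + l) + 1))).
  { apply Rmult_eq_reg_l with (X * (l ^ 4 - l ^ 2) + (l ^ 2 - l)).
    - rewrite H2. field. easy.
    - replace (X * (l ^ 4 - l ^ 2) + (l ^ 2 - l))
        with (- (l * ((1 - l) * (X * l * (1 + l) + 1)))) by ring.
      apply Ropp_neq_0_compat. auto using Rmult_integral_contrapositive_currified. }
  assert (Ha3 : a3 = (l * (l ^ 2 - beta) + (l ^ 4 - beta)) * a2 /
                     ((1 - l ^ 2) * (X * l * (1 + l ^ 2) + 1))).
  { apply Rmult_eq_reg_l with (X * (l ^ 6 - l ^ 2) + (l ^ 3 - l)).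
    - rewrite H3. field. easy.
    - replace (X * (l ^ 6 - l ^ 2) + (l ^ 3 - l))
        with (- (l * ((1 - l ^ 2) * (X * l * (1 + l ^ 2) + 1)))) by ring.
      apply Ropp_neq_0_compat. auto using Rmult_integral_contrapositive_currified. }
  split. { rewrite Hc1. apply Rmult_integral_contrapositive_currified; [lra|].
    now apply Rinv_neq_0_compat. }
  split. { rewrite Hc2, Hc3. field. lra. }
  split. { rewrite Hc1, Hc3. field. lra. }
  unfold b3, b2. fold X l. rewrite Hth, Hl1, Hc1, Hc2, Hc3, Ha3, Ha2, Hbeta.
  split.
  - field. repeat split; try nra.
  - field. repeat split; try nra.
Qed.

Theorem theorem2p2 (alpha beta : R)
    (Halpha : 0 < alpha < 1) (Hbeta : 0 <= beta < 1) :
  exists psi : R -> R,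
    is_psi alpha beta psi /\
    (forall psi' : R -> R, is_psi alpha beta psi' ->
       locally (xbar alpha beta) (fun y => psi' y = psi y)) /\
    exists sigma : R -> R,
      smooth_near sigma (xbar alpha beta) /\
      stable_manifold_is_graph (planar_map alpha beta)
        (xbar alpha beta, xbar alpha beta) sigma /\
      exists C : R,
        locally (xbar alpha beta) (fun y =>
          Rabs (sigma y - psi y) <= C * Rabs (y - xbar alpha beta) ^ 4).
Proof.
  destruct (saddle_parameters alpha beta Halpha Hbeta)
    as [HX [Hl [Hk [Hq [Hal _]]]]].
  destruct (stable_curve alpha beta (xbar alpha beta) (lambda2 alpha beta))
    as [u [rem [a2 [a3 [r [Hr [Hu [Hdu [Hrem [Ha2 [Ha3 [Hexp Hfun]]]]]]]]]]]]; try lra.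
  destruct (S_poly_coefficients alpha beta a2 a3 Halpha Hbeta Ha2 Ha3)
    as [Hc1 [Hc [Hv1 [Hv2 Hv3]]]].
  destruct (cubic_implicit_function (xbar alpha beta) _ _ _
    (b2 alpha beta) (b3 alpha beta) Hc1 Hc)
    as [psi [Hpsi [Hpsi0 [HpsiS [M [d [Hd Hstab]]]]]]].
  destruct (cubic_contact (xbar alpha beta) _ _ _ _ _ _ _ _ r u rem Hr Hl Hrem
    Hexp Hc Hv1 Hv2 Hv3) as [K [HK Hcontact]].
  change (forall x y, Rabs (x - xbar alpha beta) < d ->
    Rabs (y - xbar alpha beta) < d ->
    Rabs (x - psi y) <= M * Rabs (S_poly alpha beta x y)) in Hstab.
  set (X := xbar alpha beta) in *. set (l := lambda2 alpha beta) in *.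
  change (locally 0 (fun t => Rabs (S_poly alpha beta (X + u t) (X + u (l * t)))
    <= K * Rabs t ^ 4)) in Hcontact.
  assert (H00 : Rabs (0 - 0) < r) by now rewrite Rminus_diag, Rabs_R0.
  assert (Hu0 : u 0 = 0) by (rewrite (Hexp 0 H00); ring).
  destruct (curve_is_stable_manifold alpha beta X l r u HX Hl Hk Hr Hu Hu0 Hdu Hfun)
    as [tau [L [HL [Htau [Hsm Hgraph]]]]].
  exists psi. split; [now repeat split|]. split.
  (* The stability bound for [S] gives uniqueness: near [X] the distance from [psi'] to [psi] is at
     most a multiple of [S_poly] at [psi'], which is 0. *)
  { intros psi' [Hsm' [H0' HS']].
    assert (Hc' : continuous psi' X).
    { apply (ex_derive_continuous psi' X).
      exact (locally_singleton _ _ Hsm' 1%nat). }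
    generalize (filter_and _ _ (filter_and _ _ HS' (locally_Rabs X d Hd))
      (continuous_locally_Rabs psi' X X d Hc' H0' Hd)).
    apply filter_imp. intros y [[H1 H2] H3].
    specialize (Hstab _ _ H3 H2). rewrite H1, Rabs_R0, Rmult_0_r in Hstab.
    apply Rminus_diag_uniq, Rabs_eq_0, Rle_antisym; [easy|apply Rabs_pos]. }
  exists (fun y => X + u (tau y)). split; [easy|]. split; [easy|].
  assert (Hc' : continuous (fun y => X + u (tau y)) X).
  { apply (ex_derive_continuous (fun y => X + u (tau y)) X).
    exact (locally_singleton _ _ Hsm 1%nat). }
  assert (Htau0 : tau X = 0).
  { destruct (locally_singleton _ _ Htau) as [_ H].
    rewrite Rminus_diag, Rabs_R0, Rmult_0_r in H.
    apply Rabs_eq_0, Rle_antisym; [easy|apply Rabs_pos]. }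
  assert (HsX : X + u (tau X) = X) by (rewrite Htau0, Hu0; ring).
  destruct (locally_Rabs_inv _ _ Hcontact) as [d1 [Hd1 Hcon]].
  assert (Htd : locally X (fun y => Rabs (tau y - 0) < d1)).
  { assert (Hd1' : 0 < d1 / (L + 1)) by (apply Rdiv_lt_0_compat; lra).
    generalize (filter_and _ _ Htau (locally_Rabs X _ Hd1')).
    apply filter_imp. intros y [[_ H1] H2]. rewrite Rminus_0_r.
    apply Rle_lt_trans with (1 := H1).
    assert (H3 : (L + 1) * Rabs (y - X) < (L + 1) * (d1 / (L + 1)))
      by (apply Rmult_lt_compat_l; lra).
    replace ((L + 1) * (d1 / (L + 1))) with d1 in H3 by (field; lra).
    generalize (Rabs_pos (y - X)). lra. }
  (* The bounds chain as [M] times [S_poly], then [K] times the fourth power of [tau y], then [L]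
     times the distance of [y] to [X]; [Rabs M] is used since [M] carries no sign condition. *)
  exists (Rabs M * (K * L ^ 4)).
  generalize (filter_and _ _ (filter_and _ _ Htau Htd)
    (filter_and _ _ (locally_Rabs X d Hd) (continuous_locally_Rabs _ X X d Hc' HsX Hd))).
  apply filter_imp. intros y [[[H1 H2] H3] [H4 H5]].
  specialize (Hstab _ _ H5 H4). specialize (Hcon _ H3). rewrite H1 in Hcon.
  apply Rle_trans with (1 := Hstab).
  apply Rle_trans with (Rabs M * Rabs (S_poly alpha beta (X + u (tau y)) y)).
  { apply Rmult_le_compat_r; [apply Rabs_pos|apply Rle_abs]. }
  rewrite Rmult_assoc. apply Rmult_le_compat_l; [apply Rabs_pos|].
  apply Rle_trans with (1 := Hcon). rewrite Rmult_assoc, <- Rpow_mult_distr.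
  apply Rmult_le_compat_l; [easy|]. apply pow_incr. split; [apply Rabs_pos|easy].
Qed.
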